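(* The following inequalities hold: $L(5)\ge 8$, $L(6)\ge 12$, $L(7)\ge 20$, $L(8)\ge 32$, $L(9)\ge 48$, and $L(10)\ge 80$.
   Context: A set $\mathcal{C}\subseteq\{0,1\}^n$ is a $(d,L,n)$-code (a $(d,L)$-list decodable erasure code of length $n$) if every $d$-dimensional subcube of $\{0,1\}^n$ (a set obtained by fixing the values of some $n-d$ coordinates and letting the other $d$ coordinates vary freely) contains at most $L$ elements of $\mathcal{C}$; equivalently, for every codeword, after erasing any $d$ of its bits the remaining part has at most $L$ completions to codewords. $L(d)$ denotes the smallest integer $L$ for which there exists $\varepsilon=\varepsilon(d)>0$ such that for every $n$ there is a $(d,L,n)$-code of cardinality at least $\varepsilon 2^n$. *)

(* Defs.v *)
From mathcomp Require Import all_boot all_order all_algebra.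
From mathcomp Require Import boolp reals.

Set Implicit Arguments.
Unset Strict Implicit.
Unset Printing Implicit Defensive.

Import Order.TTheory GRing.Theory Num.Theory.

Local Open Scope ring_scope.

Notation cube n := {ffun 'I_n -> bool}.

(* The subcube through [x] whose free coordinates are those in [S]; its
   dimension is [#|S|]. *)
Definition subcube (n : nat) (S : {set 'I_n}) (x : cube n) : {set cube n} :=
  [set y : cube n | [forall i, (i \notin S) ==> (y i == x i)]].

Definition is_subcube (d n : nat) (Q : {set cube n}) : Prop :=
  exists (S : {set 'I_n}) (x : cube n), #|S| = d /\ Q = subcube S x.

(* When [n < d] there is no [d]-dimensional subcube, so every set is a code. *)
Definition is_code (d L n : nat) (C : {set cube n}) : Prop :=
  forall Q : {set cube n}, is_subcube d Q -> (#|C :&: Q| <= L)%N.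

Definition dense_codes (R : realType) (d L : nat) : Prop :=
  exists2 eps : R, 0 < eps &
    forall n : nat, exists2 C : {set cube n},
      is_code d L C & eps * 2 ^+ n <= #|C|%:R.

Lemma card_subcube_le (n : nat) (S : {set 'I_n}) (x : cube n) :
  (#|subcube S x| <= 2 ^ #|S|)%N.
Proof.
pose f (y : cube n) := [set i in S | y i].
have f_inj : {in subcube S x &, injective f}.
  move=> y z; rewrite !inE => /forallP yx /forallP zx /setP fyz.
  apply/ffunP => i; have := fyz i; rewrite !inE.
  case: (boolP (i \in S)) => //= iS _.
  by rewrite (eqP (implyP (yx i) iS)) (eqP (implyP (zx i) iS)).
rewrite -(card_in_imset f_inj) -card_powerset; apply: subset_leq_card.
apply/subsetP => _ /imsetP[y _ ->]; rewrite powersetE.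
by apply/subsetP => i; rewrite inE => /andP[].
Qed.

Lemma dense_codes_exists (R : realType) (d : nat) :
  exists L : nat, `[< dense_codes R d L >].
Proof.
exists (2 ^ d)%N; apply/asboolP; exists 1; first exact: ltr01.
move=> n; exists [set: cube n].
  by move=> _ [S [x [<- ->]]]; rewrite setTI card_subcube_le.
by rewrite mul1r cardsT card_ffun card_bool card_ord natrX.
Qed.

(* The number L(d): the least [L] with [dense_codes R d L]. Restricting to
   natural numbers loses nothing, since a cardinality bound is nonnegative. *)
Definition minL (R : realType) (d : nat) : nat :=
  ex_minn (dense_codes_exists R d).

(* Main.v *)
(** Flipping the coordinates of a tuple [t] of length [m] in a random point [x]
    gives a uniform point [y], so a random pair [(x, t)] has all [m] neighbours
    [y + e_a], [a] in [t], in [C] with probability at least [eps ^ m], by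
    convexity.  Written in terms of [x], these neighbours are the sums of [x]
    with all [e_a] but one.  Doubling the coordinates of [t] one after the other,
    with Cauchy-Schwarz, replaces each entry of [t] by a pair [a_i, b_i], so that
    every transversal of the [m] pairs has the above property for the same [x].
    The subcube spanned by the pairs then contains the [m * 2 ^ (m - 1)] points of
    [C] obtained by adding to [x] one [e_a] from each pair but one.  Leaving out
    [b_m] gives the bounds in odd dimension. *)
Require Import Defs.
From mathcomp Require Import all_boot all_order all_algebra.
From mathcomp Require Import boolp reals.
From mathcomp Require Import ring lra.

Set Implicit Arguments.
Unset Strict Implicit.
Unset Printing Implicit Defensive.

Import Order.TTheory GRing.Theory Num.Theory.

Local Open Scope ring_scope.

(** * Convexity of powers and second moments *)

(** A convex power lies above its tangent at [mu]. In the induction, multiplying by [p] leaves the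
    surplus [m.+1%:R * mu ^+ m * (p - mu) ^+ 2]. *)
Lemma exprn_tangent_le (R : realFieldType) (p mu : R) (m : nat) :
  0 <= p -> 0 <= mu ->
  mu ^+ m.+1 + m.+1%:R * mu ^+ m * (p - mu) <= p ^+ m.+1.
Proof.
move=> p0 mu0; elim: m => [|m IH]; first by rewrite expr0 !expr1; lra.
have h0 : 0 <= m.+1%:R * mu ^+ m * (p - mu) ^+ 2.
  by rewrite mulr_ge0 ?sqr_ge0 // mulr_ge0 ?ler0n ?exprn_ge0.
have := ler_wpM2l p0 IH; rewrite -exprS; apply: le_trans.
rewrite -subr_ge0; apply: le_trans h0 _.
by rewrite le_eqVlt; apply/orP; left; apply/eqP; rewrite -!natr1 !exprS; ring.
Qed.

(** Sum the tangents at [mu]: the linear terms add up to something nonnegative, since the mean of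
    [g] is at least [mu]. *)
Lemma power_mean_le (R : realFieldType) (Y : finType) (g : Y -> R) (mu : R)
    (m : nat) :
  0 <= mu -> (forall y, 0 <= g y) -> mu * #|Y|%:R <= \sum_y g y ->
  mu ^+ m * #|Y|%:R <= \sum_y g y ^+ m.
Proof.
move=> mu0 g0 hg; case: m => [|m].
  by rewrite expr0 mul1r (eq_bigr (fun=> 1)) ?sumr_const.
have: \sum_y (mu ^+ m.+1 + m.+1%:R * mu ^+ m * (g y - mu)) <= \sum_y g y ^+ m.+1.
  by apply: ler_sum => y _; apply: exprn_tangent_le.
apply: le_trans; rewrite big_split -mulr_sumr sumrB !sumr_const.
rewrite -[mu ^+ _ *+ _]mulr_natr -[mu *+ _]mulr_natr.
by rewrite lerDl mulr_ge0 ?subr_ge0 // mulr_ge0 ?ler0n ?exprn_ge0.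
Qed.

Lemma card_bad_pairs (A : finType) (Z : {set A}) :
  (#|[set p : A * A | [|| p.1 == p.2, p.1 \in Z | p.2 \in Z]]|
     <= #|A| * (1 + 2 * #|Z|))%N.
Proof.
pose D := [set (a, a) | a in [set: A]].
have sub : [set p : A * A | [|| p.1 == p.2, p.1 \in Z | p.2 \in Z]]
    \subset D :|: (setX Z setT :|: setX setT Z).
  apply/subsetP => -[a b]; rewrite !inE /= andbT.
  case/or3P => [/eqP <-|->|->]; rewrite ?orbT //.
  by apply/orP; left; apply/imsetP; exists a; rewrite ?inE.
apply: leq_trans (subset_leq_card sub) _.
apply: leq_trans (leq_card_setU _ _) _; rewrite mulnDr muln1 leq_add //.
  by rewrite (leq_trans (leq_imset_card _ _)) ?cardsT.
apply: leq_trans (leq_card_setU _ _) _.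
by rewrite !cardsX cardsT mulnCA mul2n -addnn mulnC.
Qed.

(** By Cauchy-Schwarz, [h] averages at least [delta ^+ 2 * #|Y|] over all ordered pairs. Pairs that
    are diagonal or meet [Z] form a fraction below [delta ^+ 2 / 2], so some other pair keeps half
    of that density. [Z] serves to avoid entries chosen earlier. *)
Lemma pair_density (R : realFieldType) (A Y : finType) (G : A -> Y -> bool)
    (Z : {set A}) (delta : R) :
  (0 < #|Y|)%N -> 0 <= delta ->
  (1 + 2 * #|Z|)%:R < delta ^+ 2 / 2 * #|A|%:R ->
  delta * #|A|%:R * #|Y|%:R <= \sum_a \sum_y (G a y)%:R ->
  exists a b, [/\ a != b, a \notin Z, b \notin Z &
    delta ^+ 2 / 2 * #|Y|%:R <= \sum_y (G a y && G b y)%:R].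
Proof.
move=> Y0 d0 hA; rewrite exchange_big /= => hG; apply: contrapT => noab.
pose h (p : A * A) : R := \sum_y (G p.1 y && G p.2 y)%:R.
pose B := [set p : A * A | [|| p.1 == p.2, p.1 \in Z | p.2 \in Z]].
have low : (delta * #|A|%:R) ^+ 2 * #|Y|%:R <= \sum_p h p.
  have := @power_mean_le _ _ (fun y => \sum_a (G a y)%:R) (delta * #|A|%:R) 2.
  move=> /(_ (mulr_ge0 d0 (ler0n _ _))) /(_ (fun y => sumr_ge0 _ _)).
  move=> /(_ (fun y a _ => ler0n _ _) hG) /le_trans; apply.
  rewrite exchange_big /=; apply: ler_sum => y _.
  rewrite expr2 mulr_suml le_eqVlt; apply/orP; left; apply/eqP.
  under [LHS]eq_bigr => a _ do rewrite mulr_sumr.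
  rewrite pair_big /=; apply: eq_bigr => p _.
  by rewrite -natrM mulnb.
have hY p : h p <= #|Y|%:R.
  rewrite /h -natr_sum ler_nat -sum1_card; apply: leq_sum => y _.
  by case: (_ && _).
have up : \sum_p h p <= \sum_p ((p \in B)%:R * #|Y|%:R + delta ^+ 2 / 2 * #|Y|%:R).
  have c0 : 0 <= delta ^+ 2 / 2 * #|Y|%:R.
    by rewrite mulr_ge0 ?ler0n // divr_ge0 ?sqr_ge0.
  apply: ler_sum => p _; case: (boolP (p \in B)) => [_|].
    by rewrite mul1r ler_wpDr.
  rewrite !inE !negb_or mul0r add0r => /and3P[p12 p1 p2].
  rewrite leNgt; apply/negP => /ltW hp; apply: noab.
  by exists p.1, p.2.
have {low up} := le_trans low up.
rewrite big_split /= -mulr_suml -natr_sum sumr_const card_prod.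
rewrite -big_mkcond sum1_card -[X in _ <= _ + X]mulr_natr natrM.
have := card_bad_pairs Z; rewrite -/B -(ler_nat R) natrM.
move: (hA); have : 0 < #|Y|%:R :> R by rewrite ltr0n.
have : 0 < #|A|%:R :> R.
  rewrite ltr0n lt0n; apply/eqP => A0; move: hA.
  by rewrite A0 mulr0 ltNge ler0n.
move: #|Y|%:R #|A|%:R #|B|%:R (1 + 2 * #|Z|)%:R => y a b z a0 y0 hz hb.
have b_lt : b < delta ^+ 2 / 2 * a * a.
  by apply: le_lt_trans hb _; rewrite mulrC ltr_pM2r.
have -> : (delta * a) ^+ 2 * y = (delta ^+ 2 * a * a) * y by ring.
rewrite [X in _ <= b * y + X](_ : _ = (delta ^+ 2 / 2 * a * a) * y); last by ring.
by rewrite -mulrDl ler_pM2r //; lra.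
Qed.

(** * From dense tuples to a box of transversals *)

Lemma big_tupleS (R : nmodType) (A : finType) (m : nat) (F : seq A -> R) :
  \sum_(t : m.+1.-tuple A) F t = \sum_a \sum_(t : m.-tuple A) F (a :: t).
Proof.
rewrite pair_big /=.
rewrite (reindex (fun p : A * m.-tuple A => [tuple of p.1 :: p.2])) //=.
exists (fun t : m.+1.-tuple A => (thead t, [tuple of behead t])) => [[a t] _|t _].
  by congr (_, _); apply: val_inj.
by rewrite /= -tuple_eta.
Qed.

Lemma sum_all_tuple (R : comPzRingType) (A : finType) (P : pred A) (m : nat) :
  \sum_(t : m.-tuple A) (all P t)%:R = (\sum_a (P a)%:R) ^+ m :> R.
Proof.
elim: m => [|m IH].
  rewrite expr0 (big_pred1 [tuple]) // => t.
  by rewrite [t]tuple0 /= eqxx.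
rewrite (big_tupleS _ (fun s => (all P s)%:R)) exprS -IH mulr_suml.
apply: eq_bigr => a _; rewrite mulr_sumr; apply: eq_bigr => t _.
by rewrite /= -natrM mulnb.
Qed.

Fixpoint unpair (A : Type) (u : seq (A * A)) : seq A :=
  if u is (a, b) :: u' then a :: b :: unpair u' else [::].

Fixpoint transversals (A : Type) (u : seq (A * A)) : seq (seq A) :=
  if u is (a, b) :: u' then
    map (cons a) (transversals u') ++ map (cons b) (transversals u')
  else [:: [::]].

Lemma size_unpair (A : Type) (u : seq (A * A)) : size (unpair u) = (size u).*2.
Proof. by elim: u => //= -[a b] u /= ->. Qed.

(** The first entry is doubled by [pair_density], with the tails and points together as [Y]; the
    induction then runs on the conjunction of the conditions for [a] and [b]. Adding both to [Z]
    keeps later pairs disjoint from this one. Only the bound [z] on [#|Z|] enters [N], which is thus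
    uniform in [A], [X], [G] and [Z]. *)
Lemma dense_transversals (R : realType) (m z : nat) (delta : R) :
  0 < delta -> exists N : nat, forall (A X : finType) (G : seq A -> X -> bool)
    (Z : {set A}), (N <= #|A|)%N -> (0 < #|X|)%N -> (#|Z| <= z)%N ->
    delta * #|A|%:R ^+ m * #|X|%:R <= \sum_(t : m.-tuple A) \sum_x (G t x)%:R ->
    exists u x, [/\ size u = m, uniq (unpair u),
      {in unpair u, forall a, a \notin Z} & {in transversals u, forall c, G c x}].
Proof.
elim: m z delta => [|m IH] z delta d0.
  exists 0%N => A X G Z _ X0 _.
  rewrite expr0 mulr1 (big_pred1 [tuple]) => [|t]; last by rewrite [t]tuple0 /= eqxx.
  move=> hG.
  have [x Gx|noG] := pickP (G [::]).
    by exists [::], x; split=> // c; rewrite inE => /eqP ->.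
  move: hG; rewrite big1 => [|x _]; last by rewrite /= noG.
  by rewrite leNgt mulr_gt0 // ltr0n.
have d'0 : 0 < delta ^+ 2 / 2 by rewrite divr_gt0 ?exprn_gt0.
have [N hN] := IH z.+2 _ d'0.
(* [N0] makes the pairs to be avoided sparse enough; the 1 in the maximum makes [A], hence the set
   of tails, nonempty. *)
pose N0 := Num.bound ((1 + 2 * z)%:R / (delta ^+ 2 / 2)).
exists (maxn N (maxn N0 1)) => A X G Z; rewrite !geq_max => /and3P[NA N0A A0] X0 Zz.
rewrite (big_tupleS _ (fun s => \sum_x (G s x)%:R)) => hG.
have [||||a [b [ab aZ bZ hab]]] :=
  @pair_density R A (m.-tuple A * X)%type (fun a y => G (a :: y.1) y.2) Z delta.
- by rewrite card_prod card_tuple muln_gt0 expn_gt0 A0.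
- exact: ltW.
- apply: (@le_lt_trans _ _ (1 + 2 * z)%:R).
    by rewrite ler_nat leq_add2l leq_mul2l.
  rewrite mulrC -ltr_pdivrMr //; apply: lt_le_trans (_ : N0%:R <= _).
    by apply: archi_boundP; rewrite divr_ge0 ?ler0n ?(ltW d'0).
  by rewrite ler_nat.
- rewrite card_prod card_tuple natrM natrX.
  have -> : delta * #|A|%:R * (#|A|%:R ^+ m * #|X|%:R)
    = delta * #|A|%:R ^+ m.+1 * #|X|%:R by rewrite exprS; ring.
  by apply: le_trans hG _; apply: ler_sum => a _; rewrite pair_big.
have [||||u [x [su uu uZ uG]]] :=
  hN A X (fun c x => G (a :: c) x && G (b :: c) x) (a |: (b |: Z)) => //.
- rewrite !cardsU1; apply: (@leq_add _ _ 1 z.+1); first exact: leq_b1.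
  by apply: (@leq_add _ _ 1); first exact: leq_b1.
- move: hab; rewrite card_prod card_tuple natrM natrX mulrA => /le_trans; apply.
  by rewrite pair_big.
have [au bu] : a \notin unpair u /\ b \notin unpair u.
  by split; apply/negP => /uZ; rewrite !inE eqxx ?orbT.
exists ((a, b) :: u), x; split.
- by rewrite /= su.
- by rewrite /= inE negb_or ab au bu uu.
- move=> c; rewrite /= !inE => /or3P[/eqP->|/eqP->|/uZ] //.
  by rewrite !inE !negb_or => /and3P[].
- move=> c; rewrite /= mem_cat => /orP[] /mapP[c' /uG /andP[Ga Gb] ->] //.
Qed.

(** * Neighbours in the cube, and points coded by masks *)

Definition flip (n : nat) (a : 'I_n) (x : cube n) : cube n :=
  [ffun i => x i (+) (i == a)].

Definition flips (n : nat) (s : seq 'I_n) (x : cube n) : cube n :=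
  foldr (@flip n) x s.

Lemma flipK (n : nat) (a : 'I_n) : involutive (flip a).
Proof. by move=> x; apply/ffunP => i; rewrite !ffunE addbK. Qed.

Lemma flipC (n : nat) (a b : 'I_n) (x : cube n) :
  flip a (flip b x) = flip b (flip a x).
Proof. by apply/ffunP => i; rewrite !ffunE addbAC. Qed.

Lemma flips_bij (n : nat) (s : seq 'I_n) : bijective (flips s).
Proof.
elim: s => [|a s IH] /=; first by exists id.
exact: bij_comp (inv_bij (@flipK n a)) IH.
Qed.

Lemma flipsE (n : nat) (s : seq 'I_n) (x : cube n) (i : 'I_n) :
  uniq s -> flips s x i = x i (+) (i \in s).
Proof.
elim: s => [|a s IH] /=; first by rewrite addbF.
case/andP => as_ us; rewrite ffunE IH // inE -addbA.
by case: eqP => [->|_]; rewrite ?(negbTE as_) ?addbF.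
Qed.

Lemma dense_neighbours (R : realType) (n m : nat) (C : {set cube n}) (eps : R) :
  0 <= eps -> eps * 2 ^+ n <= #|C|%:R ->
  eps ^+ m * n%:R ^+ m * #|cube n|%:R <=
    \sum_(t : m.-tuple 'I_n) \sum_x
      (all (fun a => flip a (flips t x) \in C) t)%:R.
Proof.
move=> e0 hC.
(* For each fixed [t] the shift [flips t] permutes the cube, so the base point can be made
   independent of [t]; the sum over [t] is then the [m]-th power of the number of neighbours in
   [C]. *)
have -> : \sum_(t : m.-tuple 'I_n) \sum_x
      (all (fun a => flip a (flips t x) \in C) t)%:R
    = \sum_x (\sum_a (flip a x \in C)%:R) ^+ m :> R.
  under [RHS]eq_bigr => x _ do rewrite -sum_all_tuple.
  rewrite [RHS]exchange_big; apply: eq_bigr => t _.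
  by rewrite [RHS](reindex (flips t)) //; apply/onW_bij/flips_bij.
rewrite -exprMn; apply: power_mean_le => [|x|].
- by rewrite mulr_ge0.
- exact: sumr_ge0.
(* Each direction contributes exactly [#|C|], because [flip a] is a bijection. *)
- rewrite exchange_big /= (eq_bigr (fun=> #|C|%:R)) => [|a _].
    rewrite sumr_const card_ord -[X in _ <= X]mulr_natr mulrAC ler_wpM2r ?ler0n //.
    by rewrite card_ffun card_bool card_ord natrX.
  rewrite (reindex (flip a)) /=; last exact/onW_bij/inv_bij/flipK.
  under eq_bigr => x _ do rewrite flipK.
  by rewrite -natr_sum -big_mkcond sum1_card.
Qed.

(* Masks on [unpair u]: those selecting one entry of each of the [m] pairs, and
   those selecting one entry of each pair but one. *)
Fixpoint full_masks (m : nat) : seq bitseq :=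
  if m is m'.+1 then
    [seq [:: true, false & w] | w <- full_masks m'] ++
    [seq [:: false, true & w] | w <- full_masks m']
  else [:: [::]].

Fixpoint defect_masks (m : nat) : seq bitseq :=
  if m is m'.+1 then
    [seq [:: false, false & w] | w <- full_masks m'] ++
    [seq [:: true, false & w] | w <- defect_masks m'] ++
    [seq [:: false, true & w] | w <- defect_masks m']
  else [::].

Lemma full_maskP (A : eqType) (u : seq (A * A)) (w : bitseq) :
  w \in full_masks (size u) -> mask w (unpair u) \in transversals u.
Proof.
elim: u w => [|[a b] u IH] w /=; first by rewrite inE => /eqP->.
rewrite !mem_cat => /orP[] /mapP[w' /IH hw' ->] /=.
  by rewrite map_f.
by rewrite orbC map_f.
Qed.

(** For the pair left empty, let [c] take its first entry and flip that entry back. *)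
Lemma defect_maskP (n : nat) (u : seq ('I_n * 'I_n)) (w : bitseq) (x : cube n) :
  w \in defect_masks (size u) ->
  exists c a, [/\ c \in transversals u, a \in c &
    flips (mask w (unpair u)) x = flip a (flips c x)].
Proof.
elim: u w => [|[a b] u IH] w //=.
rewrite !mem_cat => /or3P[] /mapP[w' hw' ->] /=.
- exists (a :: mask w' (unpair u)), a; split; rewrite ?mem_head //=.
    by rewrite mem_cat map_f ?full_maskP.
  by rewrite flipK.
- have [c [d [cu dc e]]] := IH _ hw'; exists (a :: c), d; split.
  + by rewrite mem_cat map_f.
  + by rewrite inE dc orbT.
  + by rewrite /= e flipC.
- have [c [d [cu dc e]]] := IH _ hw'; exists (b :: c), d; split.
  + by rewrite mem_cat orbC map_f.
  + by rewrite inE dc orbT.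
  + by rewrite /= e flipC.
Qed.

(** As [s] has no repetition, a mask can be read off from its point coordinate by coordinate, so
    distinct masks give distinct points; vanishing from position [d] on keeps these in the
    subcube. *)
Lemma card_mask_points (n d : nat) (C : {set cube n}) (s : seq 'I_n)
    (x : cube n) (W : seq bitseq) :
  uniq s -> uniq W -> {in W, forall w, size w = size s} ->
  {in W, forall w, ~~ has id (drop d w)} ->
  {in W, forall w, flips (mask w s) x \in C} ->
  (size W <= #|C :&: subcube [set i in take d s] x|)%N.
Proof.
move=> us uW sW dW CW; rewrite -(size_map (fun w => flips (mask w s) x)).
have nth_flips w i : w \in W -> i \in s ->
    flips (mask w s) x i = x i (+) nth false w (index i s).
  by move=> wW is_; rewrite flipsE ?mask_uniq // in_mask // is_.
have uW' : uniq [seq flips (mask w s) x | w <- W].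
  rewrite map_inj_in_uniq // => v w vW wW e.
  apply: (@eq_from_nth _ false); first by rewrite !sW.
  move=> i; rewrite sW // => lt_i.
  (* [i0] is only a default value for [nth]. *)
  have [i0 _] : exists i0 : 'I_n, true by case: (s) lt_i => // i0; exists i0.
  have := congr1 (fun f : cube n => f (nth i0 s i)) e.
  by rewrite /= !nth_flips ?mem_nth // index_uniq // => /addbI.
rewrite -(card_uniqP uW'); apply/subset_leq_card/subsetP => _ /mapP[w wW ->].
rewrite !inE CW //=; apply/forallP => i; apply/implyP; rewrite inE => i_take.
have [is_|nis] := boolP (i \in s); last first.
  by rewrite flipsE ?mask_uniq // in_mask // (negbTE nis) addbF.
rewrite nth_flips //; have /negbTE -> : ~~ nth false w (index i s).
  have le_d : (d <= index i s)%N.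
    rewrite leqNgt; apply: contra i_take => lt_d.
    rewrite -(nth_index i is_) -(nth_take _ lt_d) mem_nth //.
    by rewrite size_take_min leq_min lt_d index_mem.
  have [lt_w|ge_w] := ltnP (index i s) (size w); last by rewrite nth_default.
  apply: contra (dW w wW) => wi; apply/(has_nthP false).
  exists (index i s - d)%N; first by rewrite size_drop ltn_sub2r // (leq_ltn_trans le_d).
  by rewrite nth_drop subnKC.
by rewrite addbF.
Qed.

(* Only the masks supported on the first [d] positions are counted; for
   [d = m.*2.-1] this leaves out the second entry of the last pair. *)
Lemma minL_defect_masks (R : realType) (m d : nat) :
  let W := [seq w <- defect_masks m | ~~ has id (drop d w)] in
  (d <= m.*2)%N -> uniq W -> all (fun w => size w == m.*2) W ->
  (size W <= minL R d)%N.
Proof.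
move=> W dm uW /allP sW; rewrite /minL; case: ex_minnP => L /asboolP[eps e0 hL] _.
have [N hN] := @dense_transversals R m 0 (eps ^+ m) (exprn_gt0 _ e0).
have [C codeC denseC] := hL N.
have [||||u [x [su uu _ uC]]] := hN _ _
  (fun t x => all (fun a => flip a (flips t x) \in C) t) (@set0 'I_N).
- by rewrite card_ord.
- by apply/card_gt0P; exists [ffun=> false].
- by rewrite cards0.
- by rewrite card_ord; apply: dense_neighbours => //; apply: ltW.
have ss : size (unpair u) = m.*2 by rewrite size_unpair su.
apply: leq_trans (card_mask_points (d := d) (x := x) (C := C) uu uW _ _ _) _.
- by move=> w /sW/eqP ->.
- by move=> w; rewrite mem_filter => /andP[].
- move=> w; rewrite mem_filter => /andP[_]; rewrite -su => wm.
  have [c [a [cu ac ->]]] := defect_maskP x wm.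
  exact: (allP (uC _ cu)).
apply: codeC; exists [set i in take d (unpair u)], x; split=> //.
rewrite cardsE (card_uniqP (take_uniq _ uu)) size_take_min ss.
exact/minn_idPl.
Qed.

Theorem proposition1p2 (R : realType) :
  (8 <= minL R 5)%N /\ (12 <= minL R 6)%N /\ (20 <= minL R 7)%N /\
  (32 <= minL R 8)%N /\ (48 <= minL R 9)%N /\ (80 <= minL R 10)%N.
Proof.
(* The masks are enumerated by computation: [m * 2 ^ (m - 1)] of them for [d = m.*2], and
   [(m + 1) * 2 ^ (m - 2)] for [d = m.*2.-1]. *)
do !split.
- exact: (@minL_defect_masks R 3 5).
- exact: (@minL_defect_masks R 3 6).
- exact: (@minL_defect_masks R 4 7).
- exact: (@minL_defect_masks R 4 8).
- exact: (@minL_defect_masks R 5 9).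
- exact: (@minL_defect_masks R 5 10).
Qed.
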